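(* Let $\lambda_1 < \lambda_2 < \dots$ be an increasing sequence of real numbers with average gap $1$ and Poisson pair correlations. Then $\limsup_{n \to \infty} (\lambda_{n+1}-\lambda_n) > \frac{3}{2}+10^{-9}$.
   Context: An increasing sequence $(\lambda_n)_{n\ge1}$ has average gap $1$ if $\frac{1}{N}\sum_{n\le N}(\lambda_{n+1}-\lambda_n)\to 1$ as $N\to\infty$. Such a sequence has Poisson pair correlations if for every bounded interval $I\subseteq\mathbb{R}$, $\lim_{N\to\infty}\frac{1}{N}\#\{(i,j): 1\le i\ne j\le N,\ \lambda_j-\lambda_i\in I\} = |I|$, where $|I|$ is the Lebesgue measure of $I$. *)

(* Defs.v *)
From HB Require Import structures.
From mathcomp Require Import all_boot all_order all_algebra.
From mathcomp Require Import all_classical all_reals all_analysis.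

Set Implicit Arguments.
Unset Strict Implicit.
Unset Printing Implicit Defensive.

Import Order.TTheory GRing.Theory Num.Theory.
Import numFieldNormedType.Exports.

Local Open Scope classical_set_scope.
Local Open Scope ring_scope.

(* Sequences are indexed from 0, so that lam n stands for lambda_{n+1}; the
   term N = 0 of the sequences below is a harmless 0^-1 * 0 = 0. *)

Definition average_gap_one (R : realType) (lam : R^nat) : Prop :=
  (N%:R^-1 * \sum_(n < N) (lam n.+1 - lam n)) @[N --> \oo] --> (1 : R).

Definition pair_count (R : realType) (lam : R^nat) (I : interval R) (N : nat)
    : nat :=
  #|[set p : 'I_N * 'I_N | (p.1 != p.2) && (lam p.2 - lam p.1 \in I)]%SET|.

(* The limit is taken in \bar R only because lebesgue_measure is valued there;
   it is finite since I is bounded. *)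
Definition poisson_pair_correlations (R : realType) (lam : R^nat) : Prop :=
  forall I : interval R, bounded_set [set` I] ->
    (N%:R^-1 * (pair_count lam I N)%:R)%:E @[N --> \oo]
      --> lebesgue_measure [set` I].

(* Main.v *)
Require Import Defs.
From HB Require Import structures.
From mathcomp Require Import all_boot all_order all_algebra.
From mathcomp Require Import zify ring lra.
From mathcomp Require Import all_classical all_reals all_analysis.

Import Order.TTheory GRing.Theory Num.Theory.
Import numFieldNormedType.Exports.

Local Open Scope classical_set_scope.
Local Open Scope ring_scope.

(** Suppose that eventually all gaps are at most G = 3/2 + e. Among the first V
points, about G V pairs are within G, and about V of these are adjacent, so about
(G - 1) V are not. The number of non-adjacent pairs within s being increasing in s,
it is at most that for every s <= G, so at least about (s - 1/2 - e) V gaps are <= s. Integrating over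
s and comparing with the average gap 1 shows that this is sharp and that almost
no gap is shorter than 0.48. Hence the 0.48 V pairs at distance <= 0.48 live on
a very small set A of points, while there are few pairs of A at distances
between 0.48 and 0.81. Now put A into cells of width 1/100 and let h = 16: with
w the indicator of a window of h cells, the autocorrelation of the comb
w - w(. - 2h) + w(. - 4h) is a positive definite kernel equal to 3T at 0, -2T at
+-2h and T at +-4h, where T is a triangle of half-width h. The triangle at +-4h
sees almost no pairs, the others see uniform density, and A is too small for the
diagonal to matter: the total is about (3 - 4) h^2 V / 100 < 0, a contradiction. *)

(** * A positive definite kernel from the autocorrelation of a comb *)

Definition ndist (a b : nat) : nat := ((a - b) + (b - a))%N.

Definition comb : seq int :=
  nseq 16 1 ++ nseq 16 0 ++ nseq 16 (-1) ++ nseq 16 0 ++ nseq 16 1.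

Definition comb_corr (d : nat) : int :=
  \sum_(0 <= x < 80) comb`_x * comb`_(x + d).

(* In terms of T(d) = max(0, 16 - |d|) the left-hand side is
   3 T(d) - 2 T(d - 32) + T(d - 64); the sum over i expands the first two terms
   as layers, and the last one is bounded by 16 on 48 < d <= 80. *)
Lemma comb_corr_le d : comb_corr d <=
  \sum_(0 <= i < 16) (3 * (d <= i)%N%:R - 2 * (d <= 32 + i)%N%:R
                    + 2 * (d <= 16 + i)%N%:R)
  + 16 * ((d <= 80)%N%:R - (d <= 48)%N%:R).
Proof.
(* From 80 on the comb misses its translate and only the nonnegative [d <= 80] term can survive on
   the right; the smaller [d] are checked by computation. *)
have [dlt|dge] := ltnP d 80; last first.
  have far j : (j < d)%N -> (d <= j)%N = false by rewrite ltnNge => /negbTE.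
  have small i k : (i < 16)%N -> (k <= 32)%N -> (k + i < d)%N.
    move=> i16 k32; apply: leq_trans (leq_trans (_ : (_ < 80)%N) dge) => //.
    by rewrite ltnS -addnS; apply: leq_trans (leq_add k32 i16) _.
  rewrite /comb_corr big1_seq.
    rewrite big1_seq.
      rewrite add0r (far 48%N); last exact: leq_trans dge.
      by rewrite subr0 mulr_ge0.
    move=> i /=; rewrite mem_index_iota => /andP[_ i16].
    by rewrite (far i) ?(small i 0%N) // !far ?small // !mulr0 subr0 addr0.
  move=> i _; rewrite (nth_default _ (_ : _ <= i + d)%N) ?mulr0 //=.
  exact: leq_trans dge (leq_addl _ _).
have : d \in iota 0 80 by rewrite mem_iota.
move: d {dlt}; apply/allP.
rewrite /comb_corr unlock; vm_compute; reflexivity.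
Qed.

(** The comb translated to start at [c]. The guard matters: for [m < c] the truncated difference
    would read the first entry, which is 1. *)
Definition comb_at (c m : nat) : int := if (c <= m)%N then comb`_(m - c) else 0.

Lemma sum_comb_at_ge (M a b : nat) : (b <= a)%N -> (a + 80 <= M)%N ->
  \sum_(0 <= m < M) comb_at a m * comb_at b m = comb_corr (a - b).
Proof.
move=> ba aM.
rewrite (big_cat_nat (n := a)) /= ?(leq_trans (leq_addr 80 a)) //.
rewrite big1_seq ?add0r; last first.
  move=> i; rewrite mem_index_iota /comb_at => /andP[_ /andP[_ ia]].
  by rewrite leqNgt ia mul0r.
rewrite (big_cat_nat (n := (a + 80)%N)) ?leq_addr //=.
rewrite [X in _ + X]big1_seq ?addr0; last first.
  move=> i; rewrite mem_index_iota /comb_at => /andP[_ /andP[ia _]].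
  rewrite (nth_default _ (_ : size comb <= i - a)%N) ?if_same ?mul0r //=; lia.
rewrite -{1}[a]add0n big_addn addKn /comb_corr.
apply: eq_bigr => i _; rewrite /comb_at leq_addl (leq_trans ba) ?leq_addl //.
by rewrite addnK -addnBA.
Qed.

Lemma sum_comb_at (M a b : nat) : (a + 80 <= M)%N -> (b + 80 <= M)%N ->
  \sum_(0 <= m < M) comb_at a m * comb_at b m = comb_corr (ndist a b).
Proof.
move=> aM bM; have [ba|ab] := leqP b a.
  by rewrite sum_comb_at_ge // /ndist; congr comb_corr; lia.
rewrite (eq_bigr (fun m => comb_at b m * comb_at a m)); last first.
  by move=> i _; rewrite mulrC.
by rewrite sum_comb_at_ge ?(ltnW ab) // /ndist; congr comb_corr; lia.
Qed.

(** Ordered pairs, diagonal included, so that this is the sum of a kernel over the square of [A]. *)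
Definition close_pairs {T : finType} (c : T -> nat) (A : {set T}) (J : nat) : nat :=
  \sum_(a in A) \sum_(b in A) (ndist (c a) (c b) <= J)%N.

(** Summed over [A], the translated combs form a function of [m] whose square sums to this double
    sum; [M] is large enough to contain every translate. *)
Lemma sum_comb_corr_ge0 {T : finType} (c : T -> nat) (A : {set T}) :
  0 <= \sum_(a in A) \sum_(b in A) comb_corr (ndist (c a) (c b)).
Proof.
pose M := (\max_a c a + 80)%N.
have cM a : (c a + 80 <= M)%N by rewrite leq_add2r leq_bigmax.
have -> : \sum_(a in A) \sum_(b in A) comb_corr (ndist (c a) (c b)) =
    \sum_(0 <= m < M) (\sum_(a in A) comb_at (c a) m) ^+ 2.
  under eq_bigr do under eq_bigr do rewrite -(@sum_comb_at M) ?cM //.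
  under eq_bigr do rewrite exchange_big /=.
  rewrite exchange_big /=; apply: eq_bigr => m _.
  by rewrite expr2 big_distrlr.
by apply: sumr_ge0 => m _; exact: sqr_ge0.
Qed.

Lemma close_pairs_comb {T : finType} (c : T -> nat) (A : {set T}) :
  0 <= \sum_(0 <= i < 16) (3 * (close_pairs c A i)%:R
           - 2 * (close_pairs c A (32 + i))%:R + 2 * (close_pairs c A (16 + i))%:R)
       + 16 * ((close_pairs c A 80)%:R - (close_pairs c A 48)%:R) :> int.
Proof.
apply: le_trans (sum_comb_corr_ge0 c A) _.
have cpE J : (close_pairs c A J)%:R =
    \sum_(a in A) \sum_(b in A) (ndist (c a) (c b) <= J)%N%:R :> int.
  by rewrite /close_pairs natr_sum; apply: eq_bigr => a _; rewrite natr_sum.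
have E : \sum_(0 <= i < 16) (3 * (close_pairs c A i)%:R
           - 2 * (close_pairs c A (32 + i))%:R + 2 * (close_pairs c A (16 + i))%:R)
       + 16 * ((close_pairs c A 80)%:R - (close_pairs c A 48)%:R) =
  \sum_(a in A) \sum_(b in A)
   (\sum_(0 <= i < 16) (3 * (ndist (c a) (c b) <= i)%N%:R
                    - 2 * (ndist (c a) (c b) <= 32 + i)%N%:R
                    + 2 * (ndist (c a) (c b) <= 16 + i)%N%:R)
  + 16 * ((ndist (c a) (c b) <= 80)%N%:R - (ndist (c a) (c b) <= 48)%N%:R)) :> int.
  under [RHS]eq_bigr do rewrite big_split /= exchange_big /= -mulr_sumr sumrB.
  rewrite [RHS]big_split /= exchange_big /= -mulr_sumr sumrB -!cpE; congr +%R.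
  apply: eq_bigr => i _; rewrite !cpE !mulr_sumr -sumrB -big_split /=.
  apply: eq_bigr => a _; rewrite !mulr_sumr -sumrB -big_split /=.
  by [].
rewrite E; apply: ler_sum => a _; apply: ler_sum => b _; exact: comb_corr_le.
Qed.

(** * Close pairs, short gaps and the endpoints of short gaps *)

Section Counting.
Variables (R : realType) (lam : nat -> R).
Hypothesis lam_incr : {mono lam : i j / (i <= j)%N >-> i <= j}.

Definition pairs_within (V : nat) (s : R) : nat :=
  \sum_(i < V) \sum_(j < V) ((i < j)%N && (lam j - lam i <= s)%R).

Definition gaps_within (N : nat) (s : R) : nat :=
  \sum_(i < N) (lam i.+1 - lam i <= s)%R.

Definition far_pairs_within (V : nat) (s : R) : nat :=
  \sum_(i < V) \sum_(j < V) ((i.+1 < j)%N && (lam j - lam i <= s)%R).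

(** The adjacent pairs among [N.+1] points are exactly the [N] gaps. *)
Lemma pairs_withinE N s :
  pairs_within N.+1 s = (gaps_within N s + far_pairs_within N.+1 s)%N.
Proof.
have -> : gaps_within N s = (\sum_(i < N.+1) \sum_(j < N.+1)
    ((j == i.+1 :> nat) && (lam j - lam i <= s)%R))%N.
  rewrite big_ord_recr /= [X in (_ = _ + X)%N]big1 ?addn0; last first.
    by move=> j _; rewrite ltn_eqF.
  apply: eq_bigr => i _.
  rewrite (bigD1 (lift ord0 i)) //= /bump /= add1n eqxx /= big1 ?addn0 // => j.
  by rewrite -val_eqE /= /bump add1n => /negbTE ->.
rewrite -big_split; apply: eq_bigr => i _; rewrite -big_split.
apply: eq_bigr => j _ /=; rewrite [(i < j)%N]leq_eqVlt eq_sym.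
by case: eqP => [->|_] //=; rewrite ltnn addn0.
Qed.

Lemma far_pairs_within_le V s t : s <= t ->
  (far_pairs_within V s <= far_pairs_within V t)%N.
Proof.
move=> st; apply: leq_sum => i _; apply: leq_sum => j _.
by case: (_ < _)%N => //=; case: (leP _ s) => // /le_trans ->.
Qed.

Lemma gaps_within_le N s t : s <= t -> (gaps_within N s <= gaps_within N t)%N.
Proof.
move=> st; apply: leq_sum => i _.
by case: (leP _ s) => // /le_trans ->.
Qed.

(** The endpoints of the gaps of length at most [s]; for [s] = 0.48 this is the small set of the
    overview. *)
Definition crowded (N : nat) (s : R) : {set 'I_N.+1} :=
  [set i : 'I_N.+1 | [exists k : 'I_N, (lam k.+1 - lam k <= s) &&
     ((i == k :> nat) || (i == k.+1 :> nat))]].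

Lemma card_crowded_le N s : (#|crowded N s| <= 2 * gaps_within N s)%N.
Proof.
rewrite -sum1_card big_mkcond /=.
apply: (@leq_trans (\sum_(i < N.+1) \sum_(k < N) (lam k.+1 - lam k <= s)%R *
   ((i == k :> nat) + (i == k.+1 :> nat)))%N).
  apply: leq_sum => i _; rewrite inE; case: existsP => // -[k /andP[gk ik]].
  by rewrite (bigD1 k) //= gk mul1n; case: eqP ik => //= _ ->.
rewrite exchange_big big_distrr /=; apply: leq_sum => k _.
rewrite -big_distrr /= mulnC leq_mul2r big_split /=.
have E (j : 'I_N.+1) : (\sum_(i < N.+1) (i == j :> nat) = 1)%N.
  rewrite (bigD1 j) //= eqxx big1 // => i; rewrite -val_eqE.
  by move=> /negbTE ->.
by rewrite (E (widen_ord (leqnSn N) k)) (E (lift ord0 k)) orbT.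
Qed.

(** The gap after [i] and the gap before [j] both lie inside the interval from [lam i] to
    [lam j]. *)
Lemma crowdedP N s (i j : 'I_N.+1) : (i < j)%N -> lam j - lam i <= s ->
  (i \in crowded N s) && (j \in crowded N s).
Proof.
move=> ij dij.
have iN : (i < N)%N by rewrite (leq_trans ij) // -ltnS.
have jN : (j.-1 < N)%N by rewrite prednK ?(leq_ltn_trans _ ij) // -ltnS.
have j0 : (0 < j)%N by exact: leq_ltn_trans ij.
rewrite !inE; apply/andP; split; apply/existsP.
  exists (Ordinal iN) => /=; rewrite eqxx /= andbT.
  by apply: le_trans dij; rewrite lerD2r lam_incr.
exists (Ordinal jN) => /=; rewrite prednK // eqxx orbT andbT.
apply: le_trans dij; rewrite lerD2l lerN2 lam_incr; lia.
Qed.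

(** * Discretization into cells of width 1/100 *)

Section Cells.
Variable (N : nat).

Let cell (i : nat) : nat := Num.truncn ((lam i - lam 0%N) * 100).
Let A := crowded N (48 / 100).
Let close := close_pairs (fun i : 'I_N.+1 => cell i) A.
Let close_lt (J : nat) : nat :=
  \sum_(i < N.+1) \sum_(j < N.+1)
    [&& (i < j)%N, i \in A, j \in A & (ndist (cell i) (cell j) <= J)%N].

Lemma close_pairsE J : close J = (#|A| + (close_lt J + close_lt J))%N.
Proof.
pose f (i j : 'I_N.+1) : nat := [&& i \in A, j \in A & (ndist (cell i) (cell j) <= J)%N].
have fC i j : f i j = f j i.
  by rewrite /f /ndist andbCA addnC.
have -> : close J = (\sum_i \sum_j f i j)%N.
  rewrite /close /close_pairs big_mkcond; apply: eq_bigr => i _.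
  rewrite big_mkcond /f; case: (i \in A); last by rewrite big1.
  by apply: eq_bigr => j _; case: (j \in A).
have -> : close_lt J = (\sum_(i < N.+1) \sum_(j < N.+1 | (i < j)%N) f i j)%N.
  apply: eq_bigr => i _; rewrite [RHS]big_mkcond; apply: eq_bigr => j _.
  by case: (i < j)%N.
have -> : #|A| = (\sum_i f i i)%N.
  rewrite -sum1_card big_mkcond; apply: eq_bigr => i _.
  by rewrite /f /ndist subnn; case: (i \in A).
have E : (\sum_(i < N.+1) \sum_(j < N.+1 | (i < j)%N) f i j =
          \sum_(i < N.+1) \sum_(j < N.+1 | (j < i)%N) f i j)%N.
  rewrite (exchange_big_dep xpredT) //=.
  by apply: eq_bigr => i _; apply: eq_bigr => j _; exact: fC.
rewrite {2}E addnCA -!big_split /=.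
apply: eq_bigr => i _.
rewrite (bigID (fun j : 'I_N.+1 => (i < j)%N)) /=; congr addn.
rewrite (bigD1 i) ?ltnn //=; congr addn; apply: eq_bigl => j.
by rewrite -leqNgt andbC [RHS]ltn_neqAle.
Qed.

Let cell_itv i : (cell i)%:R <= (lam i - lam 0%N) * 100 < (cell i).+1%:R.
Proof. by apply: truncn_itv; rewrite mulr_ge0 // subr_ge0 lam_incr. Qed.

Let cell_le i j : (i <= j)%N -> (cell i <= cell j)%N.
Proof.
by move=> ij; rewrite le_truncn // ler_pM2r // lerD2r lam_incr.
Qed.

(** Rounding costs one cell in this direction, hence [J.+1]. *)
Lemma close_lt_le J : (close_lt J <= pairs_within N.+1 (J.+1%:R / 100))%N.
Proof.
apply: leq_sum => i _; apply: leq_sum => j _.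
case: (ltnP i j) => //= ij; case: (_ \in A) => //=; case: (_ \in A) => //=.
case: (leqP (ndist _ _)) => // + ; rewrite /ndist => ndJ.
have {ndJ} cij : (cell j <= cell i + J)%N by lia.
suff -> : lam j - lam i <= J.+1%:R / 100 by [].
have := cell_itv i; have := cell_itv j => /andP[_ h1] /andP[h2 _].
have : (cell j).+1%:R <= (cell i)%:R + J.+1%:R :> R.
  by rewrite -natrD ler_nat addnS ltnS.
lra.
Qed.

(** No cell is lost in this direction, and [J <= 48] puts both points of the pair into [A]. *)
Lemma pairs_le_close_lt J : (J <= 48)%N ->
  (pairs_within N.+1 (J%:R / 100) <= close_lt J)%N.
Proof.
move=> J48; apply: leq_sum => i _; apply: leq_sum => j _.
case: (ltnP i j) => //= ij; case: (leP (lam j - lam i)) => //= dij.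
have /(crowdedP _ _ _ _ ij) : lam j - lam i <= 48 / 100.
  by apply: le_trans dij _; rewrite ler_pM2r ?ler_nat.
rewrite -/A => /andP[-> ->] /=; rewrite lt0b /ndist.
rewrite (eqP (cell_le _ _ (ltnW ij))) add0n leq_subLR -ltnS -(@ltr_nat R).
have := cell_itv i; have := cell_itv j => /andP[h1 _] /andP[_ h2].
rewrite -addSn natrD; lra.
Qed.

(** Each point of [A] is the left end of at most one adjacent pair; all other pairs counted are
    non-adjacent. *)
Lemma close_lt_80_le : (close_lt 80 <= #|A| + far_pairs_within N.+1 (81 / 100))%N.
Proof.
rewrite -sum1_card big_mkcond -big_split; apply: leq_sum => i _ /=.
apply: (@leq_trans (\sum_(j < N.+1) ((i \in A) && (j == i.+1 :> nat)) +
    \sum_(j < N.+1) ((i.+1 < j)%N && (lam j - lam i <= 81 / 100)%R))%N).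
  rewrite -big_split; apply: leq_sum => j _ /=.
  case: (ltngtP i.+1 j) => /= [ij|ji|<-]; last first.
  - by case: (i \in A) => /=; rewrite ?andbF ?addn0 /= ?leq_b1 ?leqnn.
  - by [].
  rewrite andbF add0n; case: (_ \in A) => //=; case: (_ \in A) => //=.
  case: (leqP (ndist _ _)) => // + ; rewrite /ndist => ndJ.
  have {ndJ} cij : (cell j <= cell i + 80)%N by lia.
  suff -> : lam j - lam i <= 81 / 100 by [].
  have := cell_itv i; have := cell_itv j => /andP[_ h1] /andP[h2 _].
  have : (cell j).+1%:R <= (cell i)%:R + 81 :> R.
    by rewrite -natrD ler_nat addnS ltnS.
  lra.
rewrite leq_add2r; case: (i \in A); last by rewrite big1.
case: (ltnP i N) => iN.
  rewrite (bigD1 (Ordinal (iN : i.+1 < N.+1)%N)) //= eqxx big1 // => j.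
  by rewrite -val_eqE /= => /negbTE ->.
rewrite big1 // => j _; rewrite ltn_eqF //=.
by rewrite (leq_trans (ltn_ord j)).
Qed.

(** Each count over ordered pairs is [#|A|] plus twice the count over [i < j], which doubles the
    coefficients. The diagonal gives (3 - 2 + 2) * 16 = 48 times [#|A|], and the adjacent pairs
    within 80 cells give 32 more. *)
Lemma pairs_within_comb :
  0 <= 80 * (#|A|%:R : R) + \sum_(0 <= i < 16)
      (6 * (pairs_within N.+1 (i.+1%:R / 100))%:R
       - 4 * (pairs_within N.+1 ((32 + i)%:R / 100))%:R
       + 4 * (pairs_within N.+1 ((16 + i).+1%:R / 100))%:R)
    + 32 * ((far_pairs_within N.+1 (81 / 100))%:R
            - (pairs_within N.+1 (48 / 100))%:R).
Proof.
have := close_pairs_comb (fun i : 'I_N.+1 => cell i) A.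
rewrite -(ler0z R) rmorphD rmorph_sum rmorphM rmorphB !rmorph_nat -/close /=.
move=> /le_trans; apply.
have closeE J : (close J)%:R = #|A|%:R + ((close_lt J)%:R + (close_lt J)%:R) :> R.
  by rewrite close_pairsE !natrD.
have E : 80 * (#|A|%:R : R) = \sum_(0 <= i < 16) (3 * #|A|%:R) + 32 * #|A|%:R.
  by rewrite sumr_const_nat subn0 -mulr_natl; lra.
rewrite E [X in _ <= X + _]addrAC -big_split /= -[X in _ <= X]addrA; apply: lerD.
  rewrite !big_nat; apply: ler_sum => i /andP[_ i16].
  rewrite rmorphD rmorphB !rmorphM !rmorph_nat -/close !closeE.
  have := close_lt_le i; have := close_lt_le (16 + i).
  have : (pairs_within N.+1 ((32 + i)%:R / 100) <= close_lt (32 + i))%N.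
    by apply: pairs_le_close_lt; rewrite (leq_trans (_ : _ <= 32 + 15)%N) ?leq_add2l.
  rewrite -!(@ler_nat R); lra.
have := close_lt_80_le; have := pairs_le_close_lt 48 (leqnn 48).
rewrite -!(@ler_nat R) !closeE; lra.
Qed.

End Cells.
End Counting.

Arguments pairs_within {R}.
Arguments gaps_within {R}.
Arguments far_pairs_within {R}.
Arguments crowded {R}.

(** * Integrating the gap counts over a grid of lengths *)

Section Asymptotics.
Variables (R : realType) (lam : nat -> R).
Hypothesis lam_incr : {mono lam : i j / (i <= j)%N >-> i <= j}.

Lemma sum_affine (a b : R) (n : nat) :
  \sum_(0 <= i < n) (a + b * i%:R) = n%:R * a + b * (n%:R * (n%:R - 1) / 2).
Proof.
elim: n => [|n IHn]; first by rewrite big_nil; lra.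
by rewrite big_nat_recr //= IHn -natr1; field.
Qed.

Lemma grid_arith (e eta V g : R) : 0 <= V -> 0 <= e -> e <= 1 / 100 / 1000 ->
  0 < eta <= 1 / 1000 / 1000 ->
  2 / 100 * g + ((1 + e) / 2 - (1 + e) * (e + 3 * eta)) * V <=
    (1 / 2 + 2 * e + 2 * eta) * V ->
  g <= 2 / 1000 * V.
Proof.
move=> V0 e0 e1 /andP[h0 h1] h.
have ee : e * e <= 1 / 1000 * e by rewrite ler_wpM2r //; lra.
have eh : e * eta <= 1 / 1000 * eta by rewrite ler_wpM2r //; lra.
have c : (1 / 2 + 2 * e + 2 * eta) - ((1 + e) / 2 - (1 + e) * (e + 3 * eta))
   <= 4 / 100 / 1000 by lra.
have := ler_wpM2r V0 c; lra.
Qed.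

(** A Riemann sum of the indicator of [g <= s] for [s] up to [K%:R * e]; the extra [e] covers the
    right endpoint. *)
Lemma sum_grid_le (e g : R) (K : nat) : 0 <= e -> 0 <= g ->
  \sum_(0 <= k < K.+1) e * (g <= k%:R * e)%R%:R <= Num.max 0 (K%:R * e + e - g).
Proof.
move=> e0 g0; elim: K => [|K IHK].
  rewrite big_nat1 mul0r add0r; case: (leP g) => h; rewrite ?mulr1 ?mulr0 le_max ?lexx //.
  by apply/orP; right; lra.
rewrite big_nat_recr //= -[K.+1%:R]natr1; case: (leP g) => h; rewrite ?mulr1 ?mulr0.
  move: IHK; rewrite !le_max /Num.max; case: ltP => h2 h3; apply/orP; right; lra.
move: IHK; rewrite addr0 !le_max /Num.max; case: ltP => h2 h3; apply/orP; [right|left]; lra.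
Qed.

Variables (N n0 : nat).
Hypothesis n0N : (n0 <= N)%N.

Lemma gaps_within_ge (s : R) : (forall n, (n0 <= n)%N -> lam n.+1 - lam n <= s) ->
  (N <= gaps_within lam N s + n0)%N.
Proof.
move=> gs; have -> : (n0 = \sum_(i < N) (i < n0))%N.
  rewrite -[LHS]card_ord -sum1_card (big_ord_widen N (fun=> 1%N)) //.
  by rewrite big_mkcond.
rewrite -[X in (X <= _)%N]card_ord -sum1_card -big_split; apply: leq_sum => i _ /=.
by case: (ltnP i n0) => [|/gs ->]; rewrite ?addn1.
Qed.

(** The previous bound is summed over the gaps. The first [n0] gaps may exceed [K%:R * e], where the
    maximum is 0 and not the difference; adding back their total length repairs this. *)
Lemma sum_gaps_within_le (e : R) (K : nat) : 0 <= e ->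
  (forall n, (n0 <= n)%N -> lam n.+1 - lam n <= K%:R * e) ->
  \sum_(0 <= k < K.+1) e * (gaps_within lam N (k%:R * e))%:R <=
  N%:R * (K%:R * e + e) - (\sum_(n < N) (lam n.+1 - lam n)) + (lam n0 - lam 0%N).
Proof.
move=> e0 gK.
have -> : lam n0 - lam 0%N = \sum_(n < N) (if (n < n0)%N then lam n.+1 - lam n else 0).
  rewrite -big_mkcond -(big_ord_widen N (fun n => lam n.+1 - lam n)) //.
  by rewrite -(big_mkord xpredT (fun n => lam n.+1 - lam n)) telescope_sumr.
have -> : N%:R * (K%:R * e + e) = \sum_(n < N) (K%:R * e + e).
  by rewrite sumr_const card_ord mulr_natl.
rewrite -sumrB -big_split /=.
under eq_bigr do rewrite natr_sum mulr_sumr.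
rewrite exchange_big /=; apply: ler_sum => n _.
have g0 : 0 <= lam n.+1 - lam n by rewrite subr_ge0 lam_incr.
apply: le_trans (sum_grid_le _ _ _ e0 g0) _.
have Ke0 : 0 <= K%:R * e by rewrite mulr_ge0.
by rewrite ge_max; case: ltnP => [_|/gK h]; apply/andP; split; lra.
Qed.

(** * The contradiction on a fixed grid and a fixed number of points *)

Variable (m : nat).
Hypothesis m_gt0 : (0 < m)%N.

(** One number serves as grid step and as excess over 3/2: all multiples of 1/100 up to 3/2 are grid
    points, and the last one, of index [K], is 3/2 + [e]. *)
Let e : R := (100 * m%:R)^-1.

Hypothesis e_le : e <= 1 / 100 / 1000.

Let e_gt0 : 0 < e. Proof. by rewrite invr_gt0 mulr_gt0 ?ltr0n. Qed.

Let mulme : m%:R * e = 1 / 100.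
Proof. by rewrite /e; field; rewrite pnatr_eq0 -lt0n. Qed.

Let K : nat := (150 * m).+1.

Let grid (k : nat) : (k * m)%:R * e = k%:R / 100.
Proof. by rewrite natrM -mulrA mulme mulrA mulr1. Qed.

Let mulmK k : (k <= 150)%N -> (k * m <= K)%N.
Proof. by move=> k150; rewrite leqW // leq_mul2r k150 orbT. Qed.

Let KE : K%:R * e = 3 / 2 + e.
Proof. by rewrite /K -natr1 mulrDl grid mul1r; lra. Qed.

Variable (eta : R).
Hypothesis eta_le : 0 < eta <= 1 / 1000 / 1000.

Let V : R := N.+1%:R.

Hypothesis gap_le : forall n, (n0 <= n)%N -> lam n.+1 - lam n <= 3 / 2 + e.
Hypothesis pairs_near : forall k, (k <= K)%N ->
  `|(pairs_within lam N.+1 (k%:R * e))%:R - k%:R * e * V| <= eta * V.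
Hypothesis sum_gaps_ge : (1 - eta) * V <= \sum_(n < N) (lam n.+1 - lam n).
Hypothesis n0_le : n0.+1%:R <= eta * V.
Hypothesis initial_le : lam n0 - lam 0%N <= eta * V.

Let far : R := (far_pairs_within lam N.+1 (K%:R * e))%:R.

(** About 3/2 + [e] pairs per point lie within [K%:R * e], and all gaps but the first [n0] are among
    them, which takes away about 1. *)
Lemma far_le : far <= (1 / 2 + e + 2 * eta) * V.
Proof.
have := gaps_within_ge (K%:R * e); rewrite {1}KE => /(_ gap_le).
have := pairs_near _ (leqnn K); rewrite pairs_withinE natrD ler_norml => /andP[_].
rewrite -(@ler_nat R) natrD -/far; move: n0_le; rewrite /V -[n0.+1%:R]natr1 -[N.+1%:R]natr1 KE.
lra.
Qed.

Lemma gaps_within_grid_ge (k : nat) : (k <= K)%N ->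
  (k%:R * e - 1 / 2 - e - 3 * eta) * V <= (gaps_within lam N (k%:R * e))%:R.
Proof.
move=> kK; have := pairs_near _ kK.
rewrite pairs_withinE natrD ler_norml => /andP[+ _].
have : (far_pairs_within lam N.+1 (k%:R * e))%:R <= far.
  by rewrite ler_nat far_pairs_within_le // ler_pM2r // ler_nat.
have := far_le; lra.
Qed.

Lemma short_gaps_le : (gaps_within lam N (48 / 100))%:R <= 2 / 1000 * V.
Proof.
have V0 : 0 < V by rewrite ltr0n.
have up : \sum_(0 <= k < K.+1) e * (gaps_within lam N (k%:R * e))%:R <=
    (1 / 2 + 2 * e + 2 * eta) * V.
  apply: le_trans (sum_gaps_within_le e K (ltW e_gt0) _) _.
    by move=> n /gap_le; rewrite KE.
  have : N%:R * (K%:R * e + e) <= V * (K%:R * e + e).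
    by rewrite ler_wpM2r ?ler_nat // KE; have := e_gt0; lra.
  rewrite KE; have := sum_gaps_ge; have := initial_le; lra.
have term_ge0 k : 0 <= e * (gaps_within lam N (k%:R * e))%:R.
  by rewrite mulr_ge0 // ltW.
have lo : 2 / 100 * (gaps_within lam N (48 / 100))%:R +
    ((1 + e) / 2 - (1 + e) * (e + 3 * eta)) * V <=
    \sum_(0 <= k < K.+1) e * (gaps_within lam N (k%:R * e))%:R.
  rewrite (big_cat_nat (n := (48 * m)%N)) //=; last first.
    by rewrite leqW // mulmK.
  rewrite -[X in X <= _]add0r lerD ?sumr_ge0 //.
  rewrite (big_cat_nat (n := (50 * m)%N)) //=; last 2 first.
  - by rewrite leq_mul2r orbT.
  - by rewrite leqW // mulmK.
  apply: lerD.
    apply: (@le_trans _ _ (\sum_(48 * m <= k < 50 * m)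
        e * (gaps_within lam N (48 / 100))%:R)).
      by rewrite sumr_const_nat -mulnBl -[X in _ <= X]mulr_natl [X in _ <= X]mulrA grid.
    rewrite !big_nat; apply: ler_sum => k /andP[k48 _].
    rewrite ler_pM2l // ler_nat gaps_within_le // -grid ler_pM2r //.
    by rewrite ler_nat.
  (* From 1/2 on, the lower bound at [s] = 1/2 + l e is (l e - e - 3 eta) V; it is summed over l up
     to 100 m, and the last grid point is dropped. *)
  have -> : ((1 + e) / 2 - (1 + e) * (e + 3 * eta)) * V =
      \sum_(0 <= l < (100 * m).+1) (- (e * (e + 3 * eta) * V) + e ^+ 2 * V * l%:R).
    rewrite sum_affine -[(100 * m).+1%:R]natr1.
    have -> : (100 * m)%:R = e^-1 :> R by rewrite natrM invrK.
    by field; rewrite gt_eqF.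
  rewrite -[X in index_iota X K.+1]add0n big_addn.
  have -> : (K.+1 - 50 * m = (100 * m).+2)%N.
    by rewrite /K -[in RHS](addnK (50 * m)%N (100 * m).+2) !addSn -mulnDl.
  rewrite [X in _ <= X]big_nat_recr //=.
  rewrite -[X in X <= _]addr0 lerD //.
  rewrite !big_nat; apply: ler_sum => l /andP[_ lm].
  have lK : (l + 50 * m <= K)%N.
    by rewrite leqW // -[(150)%N]/(100 + 50)%N mulnDl leq_add2r -ltnS.
  have := gaps_within_grid_ge _ lK.
  move=> /(ler_wpM2l (ltW e_gt0)) /(le_trans _); apply.
  rewrite (natrD _ l) [(l%:R + _) * e]mulrDl grid -subr_ge0 [X in 0 <= X](_ : _ = 0) //.
  by field.
apply: grid_arith (le_trans lo up) => //; exact: ltW.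
Qed.

Lemma grid_contradiction : False.
Proof.
have V0 : 0 < V by rewrite ltr0n.
have near k : (k <= 48)%N ->
   (k%:R / 100 - eta) * V <= (pairs_within lam N.+1 (k%:R / 100))%:R <= (k%:R / 100 + eta) * V.
  move=> k48; have := pairs_near (k * m); rewrite grid ler_norml => h.
  have /h/andP[h1 h2] : (k * m <= K)%N.
    by rewrite mulmK // (leq_trans k48).
  by apply/andP; split; lra.
have := pairs_within_comb R lam lam_incr N.
have : (#|crowded lam N (48 / 100)|)%:R <= 4 / 1000 * V.
  have := card_crowded_le R lam N (48 / 100); rewrite -(@ler_nat R) natrM.
  have := short_gaps_le; lra.
have : (far_pairs_within lam N.+1 (81 / 100))%:R <= (1 / 2 + e + 2 * eta) * V.
  apply: le_trans far_le; rewrite ler_nat far_pairs_within_le // KE.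
  move: e_gt0; lra.
have [/andP[h48 _]] := near _ (leqnn 48).
have sle : \sum_(0 <= i < 16)
      (6 * (pairs_within lam N.+1 (i.+1%:R / 100))%:R
       - 4 * (pairs_within lam N.+1 ((32 + i)%:R / 100))%:R
       + 4 * (pairs_within lam N.+1 ((16 + i).+1%:R / 100))%:R) <=
    \sum_(0 <= i < 16) ((14 * eta - 54 / 100) * V + 6 / 100 * V * i%:R).
  rewrite !big_nat; apply: ler_sum => i /andP[_ i16].
  have /near/andP[_ h1] : (i < 48)%N by rewrite (leq_trans i16).
  have /near/andP[h2 _] : (32 + i <= 48)%N.
    by rewrite (leq_trans (leq_add (leqnn 32) (ltnW i16))).
  have /near/andP[_ h3] : (16 + i < 48)%N.
    by rewrite -addnS (leq_trans (leq_add (leqnn 16) i16)).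
  move: h1 h2 h3; rewrite -[i.+1]addn1 -[(16 + i).+1]addn1 -addnA !natrD /=.
  lra.
move: sle; rewrite sum_affine.
have : eta * V <= 1 / 1000 / 1000 * V by rewrite ler_pM2r //; case/andP: eta_le.
have : e * V <= 1 / 100 / 1000 * V by rewrite ler_pM2r.
(* Per point and up to small errors: -1.44 from the layers, at most 80 * 0.004 = 0.32 from the
   diagonal and 32 * (0.5 - 0.48) = 0.64 from the outer triangle, hence a negative total. *)
lra.
Qed.

End Asymptotics.

(** * From the limits to one sufficiently large number of points *)

Lemma eventually_forall_le (P : nat -> nat -> Prop) (K : nat) :
  (forall k, exists M, forall N, (M <= N)%N -> P k N) ->
  exists M, forall k N, (k <= K)%N -> (M <= N)%N -> P k N.
Proof.
move=> PM; elim: K => [|K [M HM]].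
  by have [M HM] := PM 0%N; exists M => k N; rewrite leqn0 => /eqP ->; exact: HM.
have [M' HM'] := PM K.+1; exists (maxn M M') => k N; rewrite geq_max.
by rewrite leq_eqVlt ltnS => /orP[/eqP ->|kK] /andP[h1 h2]; [exact: HM'|exact: HM].
Qed.

Lemma pair_count_pairs_within (R : realType) (lam : nat -> R)
  (lam_incr : increasing_seq lam) (s : R) (V : nat) :
  pair_count lam `[0, s] V = pairs_within lam V s.
Proof.
rewrite /pair_count /pairs_within pair_big /= -sum1_card big_mkcond /=.
apply: eq_bigr => -[i j] _ /=; rewrite inE /= in_itv /= subr_ge0 lam_incr.
by rewrite andbA -val_eqE -ltn_neqAle; case: (_ && _).
Qed.

Lemma pairs_within_eventually (R : realType) (lam : nat -> R)
  (lam_incr : increasing_seq lam) (lam_ppc : poisson_pair_correlations lam)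
  (s eta : R) : 0 <= s -> 0 < eta ->
  exists M, forall N, (M <= N)%N ->
    `|(pairs_within lam N.+1 s)%:R - s * N.+1%:R| <= eta * N.+1%:R.
Proof.
move=> s0 eta0.
have bI : bounded_set [set` `[0 : R, s]] by apply/compact_bounded/segment_compact.
have := lam_ppc _ bI; rewrite lebesgue_measure_itv /= lte_fin.
(* The grid contains [s] = 0, where the interval is a single point. *)
have -> : (if (0 < s)%R then s%:E - 0%:E else 0)%E = s%:E.
  case: ltP => [_|s0']; first by rewrite sube0.
  by congr EFin; apply/eqP; rewrite eq_le s0 s0'.
move=> /fine_cvgP[_] /cvgrPdist_le /(_ _ eta0) [M _ HM].
exists M => N MN; have V0 : 0 < N.+1%:R :> R by rewrite ltr0n.
have := HM N.+1 (leqW MN); rewrite /= pair_count_pairs_within //.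
set P := (pairs_within _ _ _)%:R; set V := N.+1%:R => h.
have -> : P - s * V = - ((s - V^-1 * P) * V) by field; rewrite gt_eqF.
by rewrite normrN normrM (ger0_norm (ltW V0)) ler_pM2r.
Qed.

Lemma sum_gaps_eventually (R : realType) (lam : nat -> R)
  (lam_gap : average_gap_one lam) (eta : R) : 0 < eta ->
  exists M, forall N, (M <= N)%N ->
    (1 - eta) * N.+1%:R <= \sum_(n < N) (lam n.+1 - lam n).
Proof.
move=> eta0; have eta2 : 0 < eta / 2 by rewrite divr_gt0.
move/cvgrPdist_le : lam_gap => /(_ _ eta2) [M _ HM].
(* Beyond 2 / [eta] the other half of [eta] absorbs the passage from [N] to [N.+1]. *)
exists (maxn M (Num.truncn (2 / eta)).+1) => N; rewrite geq_max => /andP[MN eN].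
have N0 : 0 < N%:R :> R by rewrite ltr0n (leq_ltn_trans _ eN).
have := HM N MN; rewrite /= ler_norml => /andP[_].
rewrite lerBlDr -lerBlDl -(ler_pM2l N0) mulrA mulfV ?gt_eqF // mul1r.
have : 2 / eta <= N%:R.
  by apply: le_trans (ltW (truncnS_gt _)) _; rewrite ler_nat.
rewrite ler_pdivrMr // -[N.+1%:R]natr1; lra.
Qed.

Lemma limn_esup_lt_eventually (R : realType) (u : nat -> R) (s : R) :
  (limn_esup (fun n => (u n)%:E) < s%:E)%E ->
  exists M, forall n, (M <= n)%N -> u n <= s.
Proof.
move=> /ereal_inf_lt[_ [A [M _ MA] <-] As]; exists M => n Mn.
rewrite -lee_fin; apply: le_trans (ltW As).
by apply: ereal_sup_ubound; exists n => //; exact: MA.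
Qed.

Theorem theorem1p2 (R : realType) (lam : R^nat)
  (lam_incr : increasing_seq lam)
  (lam_gap : average_gap_one lam)
  (lam_ppc : poisson_pair_correlations lam) :
  ((3 / 2 + 10 ^- 9)%:E < limn_esup (fun n => (lam n.+1 - lam n)%:E))%E.
Proof.
rewrite ltNge; apply/negP => limsup_le.
have [m [m_gt0 e_le e_gt]] : exists m : nat, [/\ (0 < m)%N,
    (100 * m%:R)^-1 <= 1 / 100 / 1000 :> R & 10 ^- 9 < (100 * m%:R)^-1 :> R].
  (* This makes the excess 1/100000, small enough for the grid argument and strictly above 10^-9, so
     the gaps are eventually below 3/2 plus the excess. *)
  exists 1000%N; split => //; first by lra.
  rewrite ltf_pV2 ?posrE; lra.
have [n0 gap_le] : exists n0, forall n, (n0 <= n)%N ->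
    lam n.+1 - lam n <= 3 / 2 + (100 * m%:R)^-1.
  apply: limn_esup_lt_eventually; apply: le_lt_trans limsup_le _.
  by rewrite lte_fin ltrD2l.
pose eta : R := 1 / 1000 / 1000.
have eta_gt0 : 0 < eta by rewrite /eta; lra.
have [M1 pairs_near] := eventually_forall_le _ (150 * m).+1
  (fun k => pairs_within_eventually R lam lam_incr lam_ppc (k%:R * (100 * m%:R)^-1) eta
    ltac:(by rewrite mulr_ge0 ?invr_ge0 ?mulr_ge0) eta_gt0).
have [M2 sum_ge] := sum_gaps_eventually R lam lam_gap eta eta_gt0.
pose C : R := n0.+1%:R + (lam n0 - lam 0%N).
have d0 : 0 <= lam n0 - lam 0%N by rewrite subr_ge0 lam_incr.
pose M3 := (Num.truncn (C / eta)).+1.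
pose N := (n0 + M1 + M2 + M3)%N.
have CN : C <= eta * N.+1%:R.
  rewrite mulrC -ler_pdivrMr //; apply: le_trans (ltW (truncnS_gt _)) _.
  by rewrite ler_nat leqW // leq_addl.
apply: (grid_contradiction R lam lam_incr N n0 _ m m_gt0 e_le eta) => //.
- by rewrite /N -!addnA leq_addr.
- by rewrite eta_gt0 lexx.
- by move=> k kK; apply: pairs_near => //; rewrite /N -!addnA addnCA leq_addr.
- by apply: sum_ge; rewrite /N -addnA addnCA leq_addr.
- by apply: le_trans CN; rewrite lerDl.
- by apply: le_trans CN; rewrite lerDr.
Qed.
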